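(* Let $F$ be a field of characteristic not two and let $E$ be a finite-dimensional vector space over $F$ with an arbitrary symmetric bilinear form $(U,V)\mapsto U\cdot V$. Suppose that $u,v,w$ are three distinct non-null projective points of $E$ and that the projective line $uw$ is perpendicular to the projective line $vw$. Then the projective quadrances $q_w=q(u,v)$, $q_u=q(v,w)$ and $q_v=q(u,w)$ satisfy $$q_w=q_u+q_v-q_uq_v.$$
   Context: A projective point $u=[U]$ is a one-dimensional subspace of $E$, spanned by a non-zero vector $U$; it is null if $U\cdot U=0$, and non-null otherwise. For distinct projective points $u,v$, $uv$ denotes the projective line through them, i.e. the two-dimensional subspace they span. For $u=[U]$, $v=[V]$, $w=[W]$, the projective lines $uw$ and $vw$ are perpendicular precisely when $$(W\cdot W)(U\cdot V)-(U\cdot W)(V\cdot W)=0.$$ The projective quadrance between non-null projective points $u=[U]$ and $v=[V]$ is $$q(u,v)=1-\frac{(U\cdot V)^2}{(U\cdot U)(V\cdot V)}.$$ The bilinear form is not assumed non-degenerate. *)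

(* Defs.v *)
From HB Require Import structures.
From mathcomp Require Import all_boot all_order all_algebra.
From mathcomp Require Import ring.

Set Implicit Arguments.
Unset Strict Implicit.
Unset Printing Implicit Defensive.

Import GRing.Theory.
Local Open Scope ring_scope.

Record ppoint (F : fieldType) (E : vectType F) :=
  PPoint { pspace :> {vspace E}; dim_pspace : \dim pspace == 1%N }.

HB.instance Definition _ (F : fieldType) (E : vectType F) :=
  [isSub for @pspace F E].
HB.instance Definition _ (F : fieldType) (E : vectType F) :=
  [Equality of ppoint E by <:].

Section Projective.
Variables (F : fieldType) (E : vectType F).
Implicit Types (u v w : ppoint E) (U V W : E) (f : {symmetric E}).

(* A spanning vector of u.  The notions below are stated on this chosen
   representative; the lemmas nullE, quadranceE and perpE show that they do
   not depend on the choice. *)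
Definition rep u : E := vpick u.

(* Two-dimensional as soon as u != v, see dim_line. *)
Definition line u v : {vspace E} := (u + v)%VS.

Definition null f u : bool := f (rep u) (rep u) == 0.

(* Meaningful for non-null points only, division by 0 being 0 otherwise. *)
Definition quadrance f u v : F :=
  1 - f (rep u) (rep v) ^+ 2 / (f (rep u) (rep u) * f (rep v) (rep v)).

(* Perpendicularity of two projective lines l = uw and m = vw with a common
   point w.  By perpE the criterion does not depend on how l and m are
   written in this form. *)
Definition perp f (l m : {vspace E}) : Prop :=
  exists u v w, [/\ u != w, v != w, l = line u w, m = line v w &
    f (rep w) (rep w) * f (rep u) (rep v)
      - f (rep u) (rep w) * f (rep v) (rep w) = 0].

Lemma rep_neq0 u : rep u != 0.
Proof. by rewrite /rep vpick0 -dimv_eq0 (eqP (dim_pspace u)). Qed.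

Lemma span_rep u : <[rep u]>%VS = u.
Proof.
apply/eqP; rewrite eqEdim -memvE memv_pick /= (eqP (dim_pspace u)).
by rewrite dim_vline rep_neq0.
Qed.

Lemma repP u U : pspace u = <[U]>%VS ->
  exists2 a, a != 0 & rep u = a *: U.
Proof.
move=> uU; have /vlineP[a ra] : rep u \in <[U]>%VS by rewrite -uU memv_pick.
exists a => //; apply: contraNneq (rep_neq0 u) => a0.
by rewrite ra a0 scale0r.
Qed.

Lemma dim_line u v : u != v -> \dim (line u v) = 2%N.
Proof.
move=> uv; rewrite /line dimv_disjoint_sum.
  by rewrite (eqP (dim_pspace u)) (eqP (dim_pspace v)).
have := dimvS (capvSl u v); rewrite (eqP (dim_pspace u)).
case def_d: (\dim _) => [|[|//]] _; first by apply/eqP; rewrite -dimv_eq0 def_d.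
case/negP: uv; rewrite -val_eqE /=.
have /eqP <- : (u :&: v == u)%VS.
  by rewrite eqEdim capvSl def_d (eqP (dim_pspace u)).
by rewrite eqEdim capvSr def_d (eqP (dim_pspace v)).
Qed.

Let formZl f a U V : f (a *: U) V = a * f U V.
Proof. exact: linearZl_LR. Qed.
Let formC f U V : f U V = f V U.
Proof. by rewrite hermC expr0 mul1r. Qed.
Let formZr f a U V : f U (a *: V) = a * f U V.
Proof. by rewrite formC formZl formC. Qed.

Lemma nullE f u U : pspace u = <[U]>%VS -> null f u = (f U U == 0).
Proof.
move=> /repP[a a0 ra].
by rewrite /null ra formZl formZr !mulf_eq0 (negPf a0).
Qed.

Lemma quadranceE f u v U V :
    pspace u = <[U]>%VS -> pspace v = <[V]>%VS ->
  quadrance f u v = 1 - f U V ^+ 2 / (f U U * f V V).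
Proof.
move=> /repP[a a0 ra] /repP[b b0 rb].
rewrite /quadrance ra rb !formZl !formZr; congr (1 - _).
have -> : (a * (b * f U V)) ^+ 2 = (a * b) ^+ 2 * f U V ^+ 2 by ring.
have -> : a * (a * f U U) * (b * (b * f V V)) = (a * b) ^+ 2 * (f U U * f V V).
  by ring.
by rewrite -mulf_div divff ?mul1r // expf_neq0 // mulf_neq0.
Qed.

Let formDl f U V W : f (U + V) W = f U W + f V W.
Proof. exact: linearDl. Qed.
Let formDr f U V W : f W (U + V) = f W U + f W V.
Proof. by rewrite formC formDl !(formC f W). Qed.

Let mem_line u v U : U \in line u v -> exists a b, U = a *: rep u + b *: rep v.
Proof.
case/memv_addP=> x; rewrite -{1}span_rep => /vlineP[a ->] [y].
by rewrite -{1}span_rep => /vlineP[b ->] ->; exists a, b.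
Qed.

Let rep_linel u v : rep u \in line u v.
Proof. by rewrite (subvP (addvSl u v)) // memv_pick. Qed.
Let rep_liner u v : rep v \in line u v.
Proof. by rewrite (subvP (addvSr u v)) // memv_pick. Qed.

Let rep_eq u v a : rep u = a *: rep v -> u = v.
Proof.
move=> ruv; apply/val_inj/eqP => /=.
rewrite eqEdim (eqP (dim_pspace u)) (eqP (dim_pspace v)) andbT.
by rewrite -span_rep -memvE ruv memvZ ?memv_pick.
Qed.

Lemma perpE f u v w U V W :
    pspace u = <[U]>%VS -> pspace v = <[V]>%VS -> pspace w = <[W]>%VS ->
    u != w -> v != w ->
  perp f (line u w) (line v w) <-> f W W * f U V - f U W * f V W = 0.
Proof.
move=> /repP[a a0 ra] /repP[b b0 rb] /repP[c c0 rc] uw vw.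
have repE : f (rep w) (rep w) * f (rep u) (rep v)
              - f (rep u) (rep w) * f (rep v) (rep w)
            = (a * b * c ^+ 2) * (f W W * f U V - f U W * f V W).
  by rewrite ra rb rc !formZl !formZr; ring.
have abc0 : a * b * c ^+ 2 != 0 by rewrite !mulf_neq0 ?expf_neq0.
split=> [|D0]; last by exists u, v, w; split=> //; rewrite repE D0 mulr0.
move=> [u' [v' [w' [uw' vw' ll mm D0]]]].
apply: (mulfI abc0); rewrite mulr0 -{}repE.
have := rep_linel u w; rewrite ll => /mem_line[p [q ->]].
have [lm | neq_lm] := eqVneq (line u w) (line v w).
  have := rep_liner u w; rewrite ll => /mem_line[r [s ->]].
  have := rep_linel v w; rewrite -lm ll => /mem_line[x [y ->]].
  have := rep_linel v' w'; rewrite -mm -lm ll => /mem_line[z [t rv']].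
  have z0 : z != 0.
    by apply: contraNneq vw' => z0; apply/eqP/(@rep_eq _ _ t);
       rewrite rv' z0 scale0r add0r.
  set A := rep u' in rv' D0 *; set B := rep w' in rv' D0 *.
  have G0 : f B B * f A A - f A B * f A B = 0.
    apply: (mulfI z0); rewrite mulr0 -[RHS]D0 rv' !(formDl, formDr, formZl, formZr).
    by ring.
  transitivity ((x * s - y * r) * (p * s - q * r)
                * (f B B * f A A - f A B * f A B)); last by rewrite G0 mulr0.
  by rewrite !(formDl, formDr, formZl, formZr) (formC f B A); ring.
have cap1 : (\dim (line u w :&: line v w) <= 1)%N.
  rewrite -ltnS -(dim_line uw) ltn_neqAle dimvS ?capvSl // andbT.
  apply: contra neq_lm => dim_cap.
  have /eqP <- : (line u w :&: line v w == line u w)%VS.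
    by rewrite eqEdim capvSl (eqP dim_cap) leqnn.
  by rewrite eqEdim capvSr (eqP dim_cap) (dim_line uw) (dim_line vw).
have cap_w' : (line u w :&: line v w)%VS = <[rep w']>%VS.
  apply/eqP; rewrite eq_sym eqEdim -memvE memv_cap {1}ll mm !rep_liner /=.
  by rewrite -mm dim_vline rep_neq0.
have /vlineP[c' ->] : rep w \in <[rep w']>%VS.
  by rewrite -cap_w' memv_cap !rep_liner.
have := rep_linel v w; rewrite mm => /mem_line[x [y ->]].
transitivity (c' ^+ 2 * p * x * (f (rep w') (rep w') * f (rep u') (rep v')
    - f (rep u') (rep w') * f (rep v') (rep w'))); last by rewrite D0 mulr0.
rewrite !(formDl, formDr, formZl, formZr) (formC f (rep w') (rep v')).
by ring.
Qed.

End Projective.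

(* Main.v *)
Require Import Defs.
From HB Require Import structures.
From mathcomp Require Import all_boot all_order all_algebra.
From mathcomp Require Import ring.

Set Implicit Arguments.
Unset Strict Implicit.
Unset Printing Implicit Defensive.

Import GRing.Theory.
Local Open Scope ring_scope.

(** The claim is equivalent to [1 - q_w = (1 - q_u) * (1 - q_v)].  By [perpE],
    perpendicularity of the lines at [w] is the equation
    [(W.W) (U.V) = (U.W) (V.W)] between spanning vectors.  Squaring it and
    dividing by [(U.U) (V.V) (W.W)^2], which is non-zero because the points
    are non-null, gives
    [(U.V)^2 / ((U.U) (V.V)) =
       (V.W)^2 / ((V.V) (W.W)) * ((U.W)^2 / ((U.U) (W.W)))],
    which is that product formula. *)

Theorem theorem8 (F : fieldType) (E : vectType F) (f : {symmetric E})
    (u v w : ppoint E) :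
  2%N \notin [pchar F] ->
  u != v -> v != w -> u != w ->
  ~~ null f u -> ~~ null f v -> ~~ null f w ->
  perp f (line u w) (line v w) ->
  let q_w := quadrance f u v in
  let q_u := quadrance f v w in
  let q_v := quadrance f u w in
  q_w = q_u + q_v - q_u * q_v.
Proof.
move=> _ _ vw uw; rewrite /null => nu nv nw.
have spanned x := esym (span_rep (E := E) x).
move=> /(perpE f (spanned u) (spanned v) (spanned w) uw vw)/subr0_eq perp_w /=.
have uvE : f (rep u) (rep v)
    = f (rep u) (rep w) * f (rep v) (rep w) / f (rep w) (rep w).
  by rewrite -perp_w mulrAC divff // mul1r.
by rewrite /quadrance uvE; field; rewrite nu nv nw.
Qed.
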